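(* Let $X$ and $Y$ be Banach spaces and let $T\in L(X)$, $C\in L(X,Y)$, $B\in L(Y,X)$ be such that $C$ is surjective, $B$ is injective and $T=BC$. Suppose that the Moore-Penrose inverse $T^{\dag}$ exists. Then the following statements are equivalent: (i) $T$ is an EP operator; (ii) $BB^{\dag}=C^{\dag}C$; (iii) $N(B^{\dag})=N(C)$; (iv) $R(B)=R(C^{\dag})$.
   Context: Banach spaces are complex; $L(X,Y)$ is the space of bounded linear maps $X\to Y$, $L(X)=L(X,X)$; $N(\cdot)$ and $R(\cdot)$ denote null space and range. An operator $S\in L(X)$ is hermitian if $\|\exp(itS)\|=1$ for all $t\in\mathbb{R}$ (on the zero space, the unique operator is regarded as hermitian). An operator $T\in L(X,Y)$ is Moore-Penrose invertible if there is $S\in L(Y,X)$ with $T=TST$, $S=STS$, and $ST\in L(X)$, $TS\in L(Y)$ hermitian; such $S$ is unique and is denoted $T^{\dag}$. An operator $T\in L(X)$ is EP if $T^{\dag}$ exists and $TT^{\dag}=T^{\dag}T$. Under the hypotheses of the claim the Moore-Penrose inverses $B^{\dag}\in L(X,Y)$ and $C^{\dag}\in L(Y,X)$ exist. *)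

(* Defs.v *)
From HB Require Import structures.
From mathcomp Require Import all_boot all_order all_algebra.
From mathcomp Require Import all_classical all_reals all_analysis.
From mathcomp Require Export complex.

Set Implicit Arguments.
Unset Strict Implicit.
Unset Printing Implicit Defensive.

Import Order.TTheory GRing.Theory Num.Theory.
Import numFieldNormedType.Exports.

Local Open Scope classical_set_scope.
Local Open Scope ring_scope.
Local Open Scope complex_scope.

Record bounded_op (R : realType) (X Y : normedModType R[i]) := BoundedOp {
  op_fun :> {linear X -> Y} ;
  op_bounded : bounded_near op_fun (nbhs (0 : X)) }.

Notation "''L' ( X , Y )" := (bounded_op X Y)
  (at level 8, format "''L' ( X ,  Y )") : type_scope.

HB.instance Definition _ (R : realType) (X Y : normedModType R[i]) :=
  gen_eqMixin 'L(X, Y).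
HB.instance Definition _ (R : realType) (X Y : normedModType R[i]) :=
  gen_choiceMixin 'L(X, Y).

Lemma op_ext (R : realType) (X Y : normedModType R[i]) (f g : 'L(X, Y)) :
  f =1 g -> f = g.
Proof.
case: f g => [f bf] [g bg] /= fg.
have {}fg : f = g.
  case: f g {bf bg} fg => [f cf] [g cg] /= /funext fg; subst g.
  congr GRing.Linear.Pack; case: cf cg => [[fD] [fZ]] [[gD] [gZ]].
  by rewrite (Prop_irrelevance fD gD) (Prop_irrelevance fZ gZ).
by subst g; rewrite (Prop_irrelevance bf bg).
Qed.

Section operations.
Context {R : realType} {X Y Z : normedModType R[i]}.

Lemma op_zero_bounded : bounded_near (\0 : X -> Y) (nbhs (0 : X)).
Proof. by apply/linear_bounded_continuous => x; exact: cvg_cst. Qed.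

Definition op_zero : 'L(X, Y) := BoundedOp op_zero_bounded.

Lemma op_scale_bounded (a : R[i]) (f : 'L(X, Y)) :
  bounded_near (a \*: f) (nbhs (0 : X)).
Proof.
apply/linear_bounded_continuous => x; apply: cvgZl_tmp.
exact: (bounded_linear_continuous (op_bounded f)).
Qed.

Definition op_scale (a : R[i]) (f : 'L(X, Y)) : 'L(X, Y) :=
  BoundedOp (op_scale_bounded a f).

Lemma op_comp_bounded (g : 'L(Y, Z)) (f : 'L(X, Y)) :
  bounded_near (g \o f) (nbhs (0 : X)).
Proof.
apply/linear_bounded_continuous => x; apply: continuous_comp.
- exact: (bounded_linear_continuous (op_bounded f)).
- exact: (bounded_linear_continuous (op_bounded g)).
Qed.

Definition op_comp (g : 'L(Y, Z)) (f : 'L(X, Y)) : 'L(X, Z) :=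
  BoundedOp (op_comp_bounded g f).

End operations.

Notation "g \oL f" := (op_comp g f) (at level 50, left associativity).

(* The norm of a module over R[i] takes its values in R[i]; they are
   nonnegative reals, so that [Re] loses nothing. *)
Definition op_norm (R : realType) (X Y : normedModType R[i]) (f : X -> Y) : R :=
  sup [set complex.Re `|f x| | x in [set x : X | `|x| <= 1]].

(* [E] is the sum of the exponential series of [A], for the operator norm. *)
Definition is_op_exp (R : realType) (X : normedModType R[i]) (A E : 'L(X, X)) :=
  (fun n : nat =>
     op_norm (fun x => E x - \sum_(k < n) (k`!%:R : R[i])^-1 *: iter k A x))
    @ \oo --> (0 : R).

Definition op_exp (R : realType) (X : normedModType R[i]) (A : 'L(X, X)) :
  'L(X, X) := xget op_zero [set E | is_op_exp A E].

(* On the zero space the exponential has norm 0, hence the first alternative. *)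
Definition hermitian (R : realType) (X : normedModType R[i]) (S : 'L(X, X)) :=
  (forall x : X, x = 0) \/
  (forall t : R, op_norm (op_exp (op_scale (0 +i* t) S)) = 1).

Definition is_MP_inverse (R : realType) (X Y : normedModType R[i])
    (T : 'L(X, Y)) (S : 'L(Y, X)) :=
  [/\ T = T \oL S \oL T, S = S \oL T \oL S,
      hermitian (S \oL T) & hermitian (T \oL S)].

Definition MP_invertible (R : realType) (X Y : normedModType R[i])
    (T : 'L(X, Y)) := exists S : 'L(Y, X), is_MP_inverse T S.

(* The Moore-Penrose inverse, with the junk value 0 if there is none. *)
Definition MP_inverse (R : realType) (X Y : normedModType R[i])
    (T : 'L(X, Y)) : 'L(Y, X) := xget op_zero [set S | is_MP_inverse T S].

Notation "T ^dag" := (MP_inverse T) (at level 2, format "T ^dag").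

Definition is_EP (R : realType) (X : normedModType R[i]) (T : 'L(X, X)) :=
  MP_invertible T /\ T \oL T^dag = T^dag \oL T.

Definition null_space (R : realType) (X Y : normedModType R[i])
    (T : 'L(X, Y)) : set X := T @^-1` [set 0].

(* Main.v *)
(* If P is a hermitian idempotent, then exp(itP) = I + (e^{it} - 1)P, so that
   t = pi gives that the reflection I - 2P is contractive.  If P and Q are
   hermitian idempotents with the same range or the same kernel, then
   D = P - Q squares to 0 and the product of their reflections is I - 2D or
   I + 2D; its powers I -+ 2nD are all contractive, hence D = 0.
   With S the Moore-Penrose inverse of T = BC one has CSB = I, so CS and SB
   are Moore-Penrose inverses of B and C.  The idempotents BB^dag and TT^dag
   share the range of B, and C^dag C and T^dag T share the kernel of C, so
   they coincide; each of (i)-(iv) then says that BB^dag = C^dag C. *)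

Require Import Defs.
From HB Require Import structures.
From mathcomp Require Import all_boot all_order all_algebra.
From mathcomp Require Import all_classical all_reals all_analysis.
From mathcomp Require Import ring.

Set Implicit Arguments.
Unset Strict Implicit.
Unset Printing Implicit Defensive.

Import Order.TTheory GRing.Theory Num.Theory.
Import numFieldNormedType.Exports.

Local Open Scope classical_set_scope.
Local Open Scope ring_scope.
Local Open Scope complex_scope.

(** * The exponential series at an imaginary number *)

Definition cis (R : realType) (t : R) : R[i] := cos t +i* sin t.

Lemma norm_cis (R : realType) (t : R) : `|cis t| = 1.
Proof. by rewrite normc_def /= cos2Dsin2 sqrtr1. Qed.

Lemma exp_coeff_imaginary (R : realType) (t : R) k :
  (k`!%:R : R[i])^-1 * (0 +i* t) ^+ k = cos_coeff t k +i* sin_coeff t k.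
Proof.
have -> : 0 +i* t = 'i * t%:C :> R[i] by simpc.
rewrite exprMn -rmorphXn /= -[in 'i ^+ k](odd_double_half k) exprD.
rewrite -mul2n exprM sqr_i /cos_coeff /sin_coeff /=.
have -> : (k`!%:R : R[i])^-1 = (k`!%:R^-1 : R)%:C.
  by rewrite fmorphV rmorph_nat.
have -> : (-1 : R[i]) ^+ k./2 = ((-1 : R) ^+ k./2)%:C.
  by rewrite rmorphXn rmorphN1.
case: (boolP (odd k)) => ko; simpc; rewrite ?(expr1, expr0).
(* [sin_coeff] carries the exponent [k.-1./2], while splitting [k] by parity produced [k./2]; the
   two agree for odd [k]. *)
- have -> : k.-1./2 = k./2.
    by rewrite -[in LHS](odd_double_half k) ko /= doubleK.
  by simpc; congr (_ +i* _); ring.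
- by simpc; congr (_ +i* _); ring.
Qed.

Lemma cvg_exp_imaginary (R : realType) (t : R) :
  (fun n => complex.Re `|cis t - \sum_(k < n) (k`!%:R)^-1 * (0 +i* t) ^+ k|)
    @ \oo --> (0 : R).
Proof.
have cosP : series (cos_coeff t) @ \oo --> cos t.
  by rewrite unlock; exact: is_cvg_series_cos_coeff.
have sinP : series (sin_coeff t) @ \oo --> sin t.
  by rewrite unlock; exact: is_cvg_series_sin_coeff.
have partial n : \sum_(k < n) (k`!%:R)^-1 * (0 +i* t) ^+ k =
    series (cos_coeff t) n +i* series (sin_coeff t) n.
  rewrite /series /= !big_mkord; elim: n => [|n IHn].
    by rewrite !big_ord0.
  by rewrite !big_ord_recr /= IHn exp_coeff_imaginary; simpc.
apply: (@squeeze_cvgr _ _ _ _ (fun=> 0)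
  (fun n => `|cos t - series (cos_coeff t) n|
            + `|sin t - series (sin_coeff t) n|)).
(* The modulus of a + ib is at most |a| + |b|: compare squares, whose difference is 2|a||b|. *)
- apply: nearW => n; rewrite partial normc_def /= sqrtr_ge0 /=.
  rewrite -(ler_pXn2r (n := 2)) ?nnegrE ?sqrtr_ge0 ?addr_ge0//.
  rewrite sqr_sqrtr ?addr_ge0 ?sqr_ge0//.
  rewrite [leRHS]sqrrD !real_normK ?num_real//.
  by rewrite addrAC lerDl mulrn_wge0// mulr_ge0.
- exact: cvg_cst.
- rewrite -[0]addr0; apply: cvgD.
  + rewrite -(@normr0 _ R) -(subrr (cos t)); apply: cvg_norm.
    by apply: cvgB => //; exact: cvg_cst.
  + rewrite -(@normr0 _ R) -(subrr (sin t)); apply: cvg_norm.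
    by apply: cvgB => //; exact: cvg_cst.
Qed.

(** * Bounds by the operator norm *)

Lemma Re_normK (R : realType) (X : normedModType R[i]) (x : X) :
  (complex.Re `|x|)%:C = `|x|.
Proof. by rewrite RRe_real// normr_real. Qed.

Lemma Re_norm_le (R : realType) (X : normedModType R[i]) (x : X) (M : R) :
  (complex.Re `|x| <= M) = (`|x| <= M%:C).
Proof. by rewrite -lecR Re_normK. Qed.

Section bounded_operators.
Context {R : realType} {X Y : normedModType R[i]}.

Lemma op_bound (f : 'L(X, Y)) :
  exists M : R, forall x : X, `|x| <= 1 -> `|f x| <= M%:C.
Proof.
have /linear_boundedP/pinfty_ex_gt0[M M0 fM] := op_bounded f.
exists (complex.Re M) => x x1; rewrite RRe_real ?gtr0_real//.
by rewrite (le_trans (fM x))// ler_piMr// ltW.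
Qed.

Lemma op_norm_le (f : X -> Y) (M : R) :
  (forall x : X, `|x| <= 1 -> `|f x| <= M%:C) -> op_norm f <= M.
Proof.
move=> fM; apply: ge_sup => [|_ [x /= x1 <-]].
- by exists (complex.Re `|f 0|); exists 0 => //=; rewrite normr0.
- by rewrite Re_norm_le fM.
Qed.

Lemma le_op_norm (f : 'L(X, Y)) (x : X) :
  `|x| <= 1 -> `|f x| <= (op_norm f)%:C.
Proof.
move=> x1; rewrite -Re_norm_le; apply: ub_le_sup; last by exists x.
have [M fM] := op_bound f; exists M => _ [y /= y1 <-].
by rewrite Re_norm_le fM.
Qed.

Lemma op_norm_ge0 (f : 'L(X, Y)) : 0 <= op_norm f.
Proof.
rewrite -lecR; by rewrite (le_trans (normr_ge0 (f 0)))// le_op_norm// normr0.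
Qed.

Lemma op_norm_le1P (f : 'L(X, Y)) :
  op_norm f <= 1 -> forall x : X, `|f x| <= `|x|.
Proof.
move=> f1 x; have [->|x0] := eqVneq x 0; first by rewrite linear0 !normr0.
have x0' : 0 < `|x| by rewrite normr_gt0.
have : `|f (`|x|^-1 *: x)| <= 1%:C.
  apply: (@le_trans _ _ (op_norm f)%:C); last by rewrite lecR.
  by apply: le_op_norm; rewrite normrZ normfV normr_id mulVf// gt_eqF.
by rewrite linearZ /= normrZ normfV normr_id ler_pdivrMl// mulr1.
Qed.

Lemma op_add_bounded (f g : 'L(X, Y)) :
  bounded_near (f \+ g) (nbhs (0 : X)).
Proof.
apply/linear_bounded_continuous => x; apply: cvgD.
- exact: (bounded_linear_continuous (op_bounded f)).
- exact: (bounded_linear_continuous (op_bounded g)).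
Qed.

Definition op_add (f g : 'L(X, Y)) : 'L(X, Y) :=
  BoundedOp (op_add_bounded f g).

End bounded_operators.

(** * The exponential of an idempotent *)

Section exponential.
Context {R : realType} {X : normedModType R[i]}.
Implicit Types (A E P Q : 'L(X, X)).

Lemma op_id_bounded : bounded_near (idfun : X -> X) (nbhs (0 : X)).
Proof. by apply/linear_bounded_continuous => x; exact: cvg_id. Qed.

Definition op_id : 'L(X, X) := BoundedOp op_id_bounded.

(** [le_op_norm] applies to bounded operators only, since [sup] is an upper bound only for bounded
    sets. This lets it be used on the error functions in [is_op_exp]. *)
Lemma op_exp_partial_sum A n : exists F : 'L(X, X),
  forall x, F x = \sum_(k < n) (k`!%:R : R[i])^-1 *: iter k A x.
Proof.
have itA k : exists F : 'L(X, X), forall x, F x = iter k A x.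
  elim: k => [|k [F FE]]; first by exists op_id.
  by exists (A \oL F) => x /=; rewrite FE.
elim: n => [|n [F FE]].
  by exists op_zero => x; rewrite big_ord0.
have [G GE] := itA n; exists (op_add F (op_scale (n`!%:R)^-1 G)) => x.
by rewrite big_ord_recr /= FE GE.
Qed.

(** On the unit ball, the distance between [E y] and [E' y] is at most the sum of the two errors at
    stage n, which tends to 0; scaling reaches all vectors. *)
Lemma is_op_exp_unique A E E' : is_op_exp A E -> is_op_exp A E' -> E = E'.
Proof.
move=> AE AE'; apply: op_ext => x.
suff ball1 y : `|y| <= 1 -> E y = E' y.
  have [->|x0] := eqVneq x 0; first by rewrite !linear0.
  have x0' : `|x| != 0 by rewrite normr_eq0.
  have : E (`|x|^-1 *: x) = E' (`|x|^-1 *: x).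
    by apply: ball1; rewrite normrZ normfV normr_id mulVf.
  by rewrite !linearZ => /(scalerI (invr_neq0 x0')).
move=> y1; apply/eqP; rewrite -subr_eq0 -normr_eq0 -Re_normK -(rmorph0 (real_complex R)).
rewrite (inj_eq (@complexI _)) eq_le; apply/andP; split; last first.
  by rewrite -lecR Re_normK normr_ge0.
pose err (G : 'L(X, X)) n :=
  op_norm (fun x => G x - \sum_(k < n) (k`!%:R : R[i])^-1 *: iter k A x).
have EE' : err E \+ err E' @ \oo --> (0 : R).
  by rewrite -[X in _ --> X]addr0; exact: cvgD AE AE'.
rewrite -(cvg_lim _ EE')//; apply: limr_ge; first by apply/cvg_ex; exists 0.
apply: nearW => n; rewrite Re_norm_le rmorphD /=.
have [F FE] := op_exp_partial_sum A n.
have D_le (G : 'L(X, X)) : `|G y - F y| <= (err G n)%:C.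
  rewrite /err; have -> : (fun x => G x - \sum_(k < n) (k`!%:R : R[i])^-1 *: iter k A x)
    = op_add G (op_scale (-1) F).
    by apply/funext => z /=; rewrite FE scaleN1r.
  have := le_op_norm (op_add G (op_scale (-1) F)) y1.
  by rewrite /= scaleN1r.
have -> : E y - E' y = (E y - F y) - (E' y - F y) by rewrite opprB addrA subrK.
by rewrite (le_trans (ler_normB _ _))// lerD.
Qed.

Lemma op_expE A E : is_op_exp A E -> op_exp A = E.
Proof.
move=> AE; rewrite /op_exp; apply: (is_op_exp_unique _ AE).
by apply: (xgetPex op_zero (P := [set E | is_op_exp A E])); exists E.
Qed.

Lemma op_exp_idempotent P (t : R) : P \oL P = P ->
  op_exp (op_scale (0 +i* t) P) = op_add op_id (op_scale (cis t - 1) P).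
Proof.
move=> PP; apply: op_expE.
have PPx x : P (P x) = P x by rewrite -[in RHS]PP.
have [M PM] := op_bound P.
have M0 : 0 <= M.
  by rewrite -lecR (le_trans (normr_ge0 (P 0)))// PM// normr0.
pose e n := cis t - \sum_(k < n) (k`!%:R : R[i])^-1 * (0 +i* t) ^+ k.
(* The term k = 0 contributes x = (x - P x) + P x and all others are multiples of P x, so the scalar
   series multiplies P x. The empty sum lacks x - P x, hence n > 0. *)
have error n x : (0 < n)%N ->
  op_add op_id (op_scale (cis t - 1) P) x
    - \sum_(k < n) (k`!%:R : R[i])^-1 *: iter k (op_scale (0 +i* t) P) x
  = e n *: P x.
  case: n => // n _.
  have -> : \sum_(k < n.+1) (k`!%:R : R[i])^-1 *: iter k (op_scale (0 +i* t) P) x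
    = x - P x + (\sum_(k < n.+1) (k`!%:R : R[i])^-1 * (0 +i* t) ^+ k) *: P x.
    elim: n => [|n IHn].
      by rewrite !big_ord1 /= fact0 invr1 expr0 mulr1 !scale1r subrK.
    have iterP k : iter k.+1 (op_scale (0 +i* t) P) x = (0 +i* t) ^+ k.+1 *: P x.
      elim: k => [|k IHk]; first by rewrite expr1.
      by rewrite iterS IHk /= linearZ /= PPx scalerA -exprS.
    rewrite big_ord_recr IHn [in RHS]big_ord_recr scalerDl addrA.
    by congr (_ + _); rewrite -scalerA -iterP.
  rewrite /e /= !scalerBl scale1r addrA [x + _ - P x]addrAC.
  by rewrite opprD addrACA subrr add0r.
have lim0 : (fun n => complex.Re `|e n| * M) @ \oo --> (0 : R).
  by rewrite -(mul0r M); apply: cvgMl; exact: cvg_exp_imaginary.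
apply: (@squeeze_cvgr _ _ _ _ (fun=> 0)
  (fun n => complex.Re `|e n| * M)) => //; last exact: cvg_cst.
exists 1%N => // n /= n0.
rewrite (_ : (fun x => _) = op_scale (e n) P); last first.
  by apply/funext => x; exact: error.
rewrite op_norm_ge0; apply: op_norm_le => x x1 /=.
by rewrite normrZ rmorphM /=; apply: ler_pM => //; exact: PM.
Qed.

(** The exponential of it times the identity is multiplication by [cis t], whose norm 1 is attained
    at any unit vector. *)
Lemma hermitian_op_id : Defs.hermitian op_id.
Proof.
have [X0|/existsNP[x x0]] := pselect (forall x : X, x = 0); first by left.
right=> t; rewrite op_exp_idempotent; last exact: op_ext.
have idE y : op_add op_id (op_scale (cis t - 1) op_id) y = cis t *: y.
  by rewrite /= scalerBl scale1r addrC subrK.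
apply/eqP; rewrite eq_le; apply/andP; split.
  by apply: op_norm_le => y y1; rewrite idE normrZ norm_cis mul1r.
have x0' : `|x| != 0 by rewrite normr_eq0; exact/eqP.
have x1 : `| `|x|^-1 *: x| = 1 by rewrite normrZ normfV normr_id mulVf.
rewrite -lecR -[X in X <= _](_ : `|cis t *: (`|x|^-1 *: x)| = _).
  by rewrite -idE; apply: le_op_norm; rewrite x1.
by rewrite normrZ norm_cis x1 mul1r.
Qed.

(** * Hermitian idempotents with a common range or kernel *)

Lemma hermitian_idempotent_reflection P : Defs.hermitian P -> P \oL P = P ->
  forall x, `|x - 2 *: P x| <= `|x|.
Proof.
move=> [X0|hP] PP x; first by rewrite [x]X0 linear0 scaler0 subr0.
have := hP pi; rewrite op_exp_idempotent// => norm1.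
have /op_norm_le1P/(_ x) : op_norm (op_add op_id (op_scale (cis pi - 1) P)) <= 1.
  by rewrite norm1.
rewrite /= /cis cospi sinpi.
have -> : (-1 +i* 0) - 1 = - 2 :> R[i] by simpc; rewrite -opprD.
by rewrite scaleNr.
Qed.

(* As [(P - Q)^2 = 0], the n-th power of the product of the two reflections is
   [I + n s (P - Q)]; it is contractive for every n. *)
Lemma reflections_eq P Q (s : R[i]) : s != 0 ->
  (forall x, `|x - 2 *: P x| <= `|x|) -> (forall x, `|x - 2 *: Q x| <= `|x|) ->
  (forall x, (x - 2 *: Q x) - 2 *: P (x - 2 *: Q x) = x + s *: (P x - Q x)) ->
  (forall x, P (P x - Q x) = Q (P x - Q x)) ->
  P = Q.
Proof.
move=> s0 rP rQ PQ D2; apply: op_ext => x.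
pose D := P x - Q x; have PD : P D = Q D by exact: D2.
have bnd n : `|x + (s *+ n) *: D| <= `|x|.
  elim: n => [|n IHn]; first by rewrite mulr0n scale0r addr0.
  apply: le_trans IHn.
  (* As P and Q agree on D, adding a multiple of D to x does not change P x - Q x. *)
  have -> : x + (s *+ n.+1) *: D =
      (x + (s *+ n) *: D) + s *: (P (x + (s *+ n) *: D) - Q (x + (s *+ n) *: D)).
    have lin (F : 'L(X, X)) (a : R[i]) : F (x + a *: D) = F x + a *: F D.
      by rewrite linearD linearZ.
    rewrite !lin PD opprD addrACA subrr addr0 -/D.
    by rewrite mulrSr scalerDl addrA.
  by rewrite -PQ (le_trans (rP _)).
apply/eqP; rewrite -subr_eq0 -/D -normr_eq0; apply: contraT => D0.
have sD0 : 0 < complex.Re `|s *: D|.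
  rewrite -ltcR Re_normK lt_def normr_ge0 normrZ mulf_neq0//.
  by rewrite normr_eq0.
have xD0 : 0 <= 2 * complex.Re `|x| / complex.Re `|s *: D|.
  by rewrite divr_ge0 ?(ltW sD0)// mulr_ge0// -lecR Re_normK normr_ge0.
(* This n makes the norm of n s D exceed 2|x|, yet n s D = (x + n s D) - x has norm at most 2|x|. *)
have := archi_boundP xD0; set n := Num.bound _.
rewrite ltr_pdivrMr// ltNge => /negP[].
rewrite -lecR !rmorphM /= !Re_normK !rmorph_nat mulr_natl -normrMn.
rewrite scalerMnl -[X in `|X|](addrK x) [_ + x]addrC.
by rewrite mulr_natl mulr2n (le_trans (ler_normB _ _))// lerD.
Qed.

(** Each idempotent fixes the common range, so PQ = Q and QP = P. Then (I - 2P)(I - 2Q) = I - 2(P -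
    Q), whence s = -2. *)
Lemma hermitian_idempotent_eq_range P Q :
  Defs.hermitian P -> Defs.hermitian Q -> P \oL P = P -> Q \oL Q = Q ->
  range P = range Q -> P = Q.
Proof.
move=> hP hQ PP QQ PQ.
have PPx x : P (P x) = P x by rewrite -[in RHS]PP.
have QQx x : Q (Q x) = Q x by rewrite -[in RHS]QQ.
have PQx x : P (Q x) = Q x.
  have [y _ <-] : range P (Q x) by rewrite PQ; exists x.
  exact: PPx.
have QPx x : Q (P x) = P x.
  have [y _ <-] : range Q (P x) by rewrite -PQ; exists x.
  exact: QQx.
apply: (@reflections_eq P Q (-2)) => [|||x|x].
- by rewrite oppr_eq0 pnatr_eq0.
- exact: hermitian_idempotent_reflection.
- exact: hermitian_idempotent_reflection.
- have -> : P (x - 2 *: Q x) = P x - 2 *: Q x by rewrite linearB linearZ /= PQx.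
  rewrite -addrA -opprD -scalerDr addrCA [2 *: Q x]scaler_nat mulr2n opprD.
  by rewrite [Q x + _]addrA subrr sub0r scaleNr.
- by rewrite !linearB /= PPx PQx QPx QQx.
Qed.

(** Q x - x lies in the common kernel, so PQ = P, and likewise QP = Q. Then (I - 2P)(I - 2Q) = I +
    2(P - Q), whence s = 2. *)
Lemma hermitian_idempotent_eq_ker P Q :
  Defs.hermitian P -> Defs.hermitian Q -> P \oL P = P -> Q \oL Q = Q ->
  null_space P = null_space Q -> P = Q.
Proof.
move=> hP hQ PP QQ PQ.
have PPx x : P (P x) = P x by rewrite -[in RHS]PP.
have QQx x : Q (Q x) = Q x by rewrite -[in RHS]QQ.
have PQx x : P (Q x) = P x.
  apply/eqP; rewrite -subr_eq0 -linearB; apply/eqP.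
  have : null_space Q (Q x - x) by rewrite /null_space /= linearB QQx subrr.
  by rewrite -PQ.
have QPx x : Q (P x) = Q x.
  apply/eqP; rewrite -subr_eq0 -linearB; apply/eqP.
  have : null_space P (P x - x) by rewrite /null_space /= linearB PPx subrr.
  by rewrite PQ.
apply: (@reflections_eq P Q 2) => [|||x|x].
- by rewrite pnatr_eq0.
- exact: hermitian_idempotent_reflection.
- exact: hermitian_idempotent_reflection.
- have -> : P (x - 2 *: Q x) = P x - 2 *: P x by rewrite linearB linearZ /= PQx.
  rewrite -addrA; congr (_ + _).
  have -> : P x - 2 *: P x = - P x.
    by rewrite scaler_nat mulr2n opprD addrA subrr sub0r.
  by rewrite scalerN opprK addrC -scalerBr.
- by rewrite !linearB /= PPx PQx QPx QQx !subrr.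
Qed.

End exponential.

(** * Ranges and kernels of Moore-Penrose projections *)

Section moore_penrose.
Context {R : realType} {X Y : normedModType R[i]}.

Lemma MP_inverseP (T : 'L(X, Y)) :
  MP_invertible T -> is_MP_inverse T T^dag.
Proof. exact: xgetPex. Qed.

Lemma is_MP_inverse_idempotentl (T : 'L(X, Y)) S : is_MP_inverse T S ->
  (S \oL T) \oL (S \oL T) = S \oL T.
Proof. by case=> _ SE _ _; apply: op_ext => x; rewrite [in RHS]SE. Qed.

Lemma is_MP_inverse_idempotentr (T : 'L(X, Y)) S : is_MP_inverse T S ->
  (T \oL S) \oL (T \oL S) = T \oL S.
Proof. by case=> TE _ _ _; apply: op_ext => x; rewrite [in RHS]TE. Qed.

Lemma is_MP_inverse_range (T : 'L(X, Y)) S : is_MP_inverse T S ->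
  range (T \oL S) = range T.
Proof.
case=> TE _ _ _; apply/seteqP; split=> _ [x _ <-]; first by exists (S x).
by exists (T x) => //; rewrite [in RHS]TE.
Qed.

Lemma is_MP_inverse_ker (T : 'L(X, Y)) S : is_MP_inverse T S ->
  null_space (S \oL T) = null_space T.
Proof.
case=> TE _ _ _; apply/seteqP; split=> x; rewrite /null_space /= => Tx0.
- by rewrite TE /= Tx0 linear0.
- by rewrite Tx0 linear0.
Qed.

(** Turns the range and kernel lemmas into statements about the range of [C^dag] and the kernel of
    [B^dag]. *)
Lemma is_MP_inverse_sym (T : 'L(X, Y)) S :
  is_MP_inverse T S -> is_MP_inverse S T.
Proof. by case. Qed.

End moore_penrose.

Theorem theorem3p2 (R : realType) (X Y : completeNormedModType R[i])
    (T : 'L(X, X)) (C : 'L(X, Y)) (B : 'L(Y, X))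
    (C_surj : forall y : Y, exists x : X, C x = y)
    (B_inj : injective B)
    (T_eq : T = B \oL C)
    (T_MP : MP_invertible T) :
  [<-> is_EP T;
       B \oL B^dag = C^dag \oL C;
       null_space B^dag = null_space C;
       range B = range C^dag].
Proof.
have Tdag := MP_inverseP T_MP; have [TE SE hST hTS] := Tdag.
set S := T^dag in Tdag TE SE hST hTS *.
(* T = TST reads B(CSB)C = BC; injectivity of B cancels it on the left, surjectivity of C on the
   right. *)
have CSB : C \oL S \oL B = op_id.
  apply: op_ext => y; have [x <-] := C_surj y; apply: B_inj.
  by have := congr1 (fun F : 'L(X, X) => F x) TE; rewrite T_eq.
have CSBx y : C (S (B y)) = y.
  by have := congr1 (fun F : 'L(Y, Y) => F y) CSB.
(* The witness CS rules out the default value of [B^dag]: (CS)B is the identity and B(CS) = TS is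
   hermitian by assumption. *)
have Bdag : is_MP_inverse B B^dag.
  apply: MP_inverseP; exists (C \oL S); split.
  - by apply: op_ext => y /=; rewrite CSBx.
  - by apply: op_ext => x /=; rewrite CSBx.
  - by rewrite CSB; exact: hermitian_op_id.
  - rewrite (_ : B \oL (C \oL S) = T \oL S)//.
    by apply: op_ext => x; rewrite T_eq.
have Cdag : is_MP_inverse C C^dag.
  apply: MP_inverseP; exists (S \oL B); split.
  - by apply: op_ext => y /=; rewrite CSBx.
  - by apply: op_ext => x /=; rewrite CSBx.
  - rewrite (_ : S \oL B \oL C = S \oL T)//.
    by apply: op_ext => x; rewrite T_eq.
  - rewrite (_ : C \oL (S \oL B) = op_id); first exact: hermitian_op_id.
    by rewrite -CSB; exact: op_ext.
have BBi := is_MP_inverse_idempotentr Bdag.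
have CCi := is_MP_inverse_idempotentl Cdag.
have [_ _ _ hBB] := Bdag; have [_ _ hCC _] := Cdag.
have BB : B \oL B^dag = T \oL S.
  apply: hermitian_idempotent_eq_range => //.
    exact: is_MP_inverse_idempotentr.
  rewrite (is_MP_inverse_range Bdag) (is_MP_inverse_range Tdag) T_eq.
  (* B and BC have the same range because C is surjective. *)
  apply/seteqP; split=> _ [y _ <-]; last by exists (C y).
  by have [x <-] := C_surj y; exists x.
have CC : C^dag \oL C = S \oL T.
  apply: hermitian_idempotent_eq_ker => //.
    exact: is_MP_inverse_idempotentl.
  rewrite (is_MP_inverse_ker Cdag) (is_MP_inverse_ker Tdag) T_eq.
  (* C and BC have the same kernel because B is injective. *)
  apply/seteqP; split=> x; rewrite /null_space /= => Cx0.
    by rewrite Cx0 linear0.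
  by apply: B_inj; rewrite Cx0 linear0.
have kerB := is_MP_inverse_ker (is_MP_inverse_sym Bdag).
have kerC := is_MP_inverse_ker Cdag.
have rangeB := is_MP_inverse_range Bdag.
have rangeC := is_MP_inverse_range (is_MP_inverse_sym Cdag).
(* The cycle (i) to (iv) and back. Statements (iii) and (iv) compare the kernels and the ranges of
   the hermitian idempotents of (ii), and either equality forces these to coincide. *)
tfae.
- by case=> _ EP; rewrite BB CC.
- by move=> BC; rewrite -kerB -kerC BC.
- move=> kerBC; rewrite -rangeB -rangeC.
  suff -> : B \oL B^dag = C^dag \oL C by [].
  by apply: hermitian_idempotent_eq_ker => //; rewrite kerB kerC.
- move=> rangeBC; split=> //; rewrite -/S -BB -CC.
  by apply: hermitian_idempotent_eq_range => //; rewrite rangeB rangeC.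
Qed.
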